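(* Let $(R,\mathfrak m)$ be a $1$-dimensional regular local ring with fraction field $Q$, and let $M$ and $N$ be any $R$-modules. Then $\operatorname{Ext}^1_R(M,N)$ is weakly cotorsion, i.e. $\operatorname{Ext}^1_R\bigl(Q,\operatorname{Ext}^1_R(M,N)\bigr)=0$.
   Context: For an integral domain $R$ with fraction field $Q$, an $R$-module $X$ is called weakly cotorsion if $\operatorname{Ext}^1_R(Q,X)=0$. *)

(* Defs.v *)
From HB Require Import structures.
From mathcomp Require Import all_boot all_algebra.
From mathcomp Require Import boolp functions.
From mathcomp Require Import freeg.

Set Implicit Arguments.
Unset Strict Implicit.
Unset Printing Implicit Defensive.

Import GRing.Theory.
Import Quotient.

Local Open Scope ring_scope.
Local Open Scope quotient_scope.

Section Kernel.
Variables (R : pzRingType) (U V : lmodType R) (f : {linear U -> V}).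

Definition ker_pred : {pred U} := [pred x | f x == 0].

Fact ker_pred_submod_closed : submod_closed ker_pred.
Proof.
split=> [|a x y]; rewrite !inE ?linear0 ?eqxx // => /eqP fx /eqP fy.
by rewrite linearP fx fy scaler0 addr0.
Qed.

HB.instance Definition _ :=
  GRing.isSubmodClosed.Build R U ker_pred
    (GRing.submod_closed_semi ker_pred_submod_closed).

Record kernel := Kernel { kernel_val :> U; _ : kernel_val \in ker_pred }.

HB.instance Definition _ := [isSub for kernel_val].
HB.instance Definition _ := [Choice of kernel by <:].
HB.instance Definition _ := [SubChoice_isSubLmodule of kernel by <:].

End Kernel.

Section Cohomology.
Variables (R : pzRingType) (A B C : lmodType R).
Variables (f : {linear A -> B}) (g : {linear B -> C}).

Definition coboundary : {pred kernel g} :=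
  [pred z : kernel g | `[< exists a, f a = val z >]].

Fact coboundary_submod_closed : submod_closed coboundary.
Proof.
split=> [|c x y]; rewrite !inE.
  by apply/asboolP; exists 0; rewrite linear0 linear0.
move=> /asboolP[a fa] /asboolP[b fb]; apply/asboolP; exists (c *: a + b).
by rewrite !linearP fa fb.
Qed.

HB.instance Definition _ := GRing.isSubmodClosed.Build R (kernel g) coboundary
  (GRing.submod_closed_semi coboundary_submod_closed).

(* ker g / im f, for a complex A -> B -> C *)
Definition cohomology := {quot coboundary}.

HB.instance Definition _ := GRing.Zmodule.on cohomology.
HB.instance Definition _ := ZmodQuotient.on cohomology.

Definition cohomology_scale (a : R) : cohomology -> cohomology :=
  fun x => \pi_cohomology (a *: repr x).

Lemma pi_cohomology_scale a x :
  cohomology_scale a (\pi_cohomology x) = \pi_cohomology (a *: x).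
Proof.
apply/eqP; rewrite /cohomology_scale -[_ == _]idealrBE -scalerBr.
by rewrite rpredZ // idealrBE reprK.
Qed.

Fact cohomology_scaleA a b x :
  cohomology_scale a (cohomology_scale b x) = cohomology_scale (a * b) x.
Proof.
by rewrite -[x]reprK (pi_cohomology_scale b) !pi_cohomology_scale scalerA.
Qed.

Fact cohomology_scale1 : left_id 1 cohomology_scale.
Proof. by move=> x; rewrite -[x]reprK pi_cohomology_scale scale1r. Qed.

Fact cohomology_scaleDr : right_distributive cohomology_scale +%R.
Proof.
move=> a x y; rewrite -[x]reprK -[y]reprK -raddfD !pi_cohomology_scale.
by rewrite scalerDr raddfD.
Qed.

Fact cohomology_scaleDl x : {morph cohomology_scale^~ x : a b / a + b}.
Proof.
by move=> a b; rewrite -[x]reprK !pi_cohomology_scale scalerDl raddfD.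
Qed.

HB.instance Definition _ := GRing.Zmodule_isLmodule.Build R cohomology
  cohomology_scaleA cohomology_scale1 cohomology_scaleDr cohomology_scaleDl.

End Cohomology.

Section Hom.
Variables (R : comPzRingType) (U V : lmodType R).

Definition hom_pred : {pred U -> V} := [pred f | `[< linear f >]].

Fact hom_pred_submod_closed : submod_closed hom_pred.
Proof.
split=> [|c f g]; rewrite !inE.
  by apply/asboolP => a x y; rewrite /GRing.zero /= scaler0 addr0.
move=> /asboolP fL /asboolP gL; apply/asboolP => a x y.
have E z : (c *: f + g) z = c *: f z + g z by [].
by rewrite !E fL gL !scalerDr !scalerA mulrC addrACA.
Qed.

HB.instance Definition _ := GRing.isSubmodClosed.Build R (U -> V) hom_pred
  (GRing.submod_closed_semi hom_pred_submod_closed).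

Record hom := Hom { hom_val :> U -> V; _ : hom_val \in hom_pred }.

HB.instance Definition _ := [isSub for hom_val].
HB.instance Definition _ := [Choice of hom by <:].
HB.instance Definition _ := [SubChoice_isSubLmodule of hom by <:].

Lemma hom_linear (f : hom) : linear f.
Proof. by apply/asboolP; exact: (valP f). Qed.

HB.instance Definition _ (f : hom) :=
  GRing.isLinear.Build R U V *:%R f (hom_linear f).

End Hom.

Section Precomp.
Variables (R : comPzRingType) (U V N : lmodType R) (d : {linear U -> V}).

Fact precomp_subproof (f : hom V N) : (f \o d) \in @hom_pred R U N.
Proof. by rewrite inE; apply/asboolP => a x y /=; rewrite !linearP. Qed.

Definition precomp (f : hom V N) : hom U N := Hom (precomp_subproof f).

Fact precomp_linear : linear precomp.
Proof. by move=> a f g; apply: val_inj. Qed.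

HB.instance Definition _ := GRing.isLinear.Build R (hom V N) (hom U N) *:%R
  precomp precomp_linear.

End Precomp.

Arguments precomp {R U V} N d f.

Section FreeResolution.
Variable R : nzRingType.

Definition cover (V : lmodType R) : {freeg V / R} -> V := fglift id.

Fact cover_linear (V : lmodType R) : linear (@cover V).
Proof.
have cB : {morph @cover V : D1 D2 / D1 - D2} := lift_is_additive id.
have c0 : cover (0 : {freeg V / R}) = 0 by rewrite -(subrr 0) cB subrr.
have cD : {morph @cover V : D1 D2 / D1 + D2}.
  by move=> D1 D2; rewrite -{1}[D2]opprK cB -[- D2]sub0r cB c0 sub0r opprK.
have csum (F : V -> {freeg V / R}) s :
    cover (\sum_(x <- s) F x) = \sum_(x <- s) cover (F x).
  exact: (big_morph _ cD c0).
move=> a D1 D2; rewrite cD; congr (_ + _).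
rewrite [a *: D1]/(fgscale a D1) csum -[in RHS](freeg_sumE D1) csum scaler_sumr.
by apply: eq_bigr => x _; rewrite /cover !liftU scalerA.
Qed.

HB.instance Definition _ (V : lmodType R) :=
  GRing.isLinear.Build R {freeg V / R} V *:%R (@cover V) (@cover_linear V).

(* The canonical free resolution of M: P_n is the free module on the underlying
   set of the n-th syzygy Z_n, where Z_0 = M and Z_(n+1) is the kernel of the
   evaluation map P_n -> Z_n. *)
Fixpoint syzygy (M : lmodType R) (n : nat) : lmodType R :=
  if n is n'.+1 then kernel (@cover (syzygy M n')) else M.

Definition free_res (M : lmodType R) (n : nat) : lmodType R :=
  {freeg (syzygy M n) / R}.

Definition free_res_diff (M : lmodType R) (n : nat) :
    {linear free_res M n.+1 -> free_res M n} :=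
  (\val : kernel (@cover (syzygy M n)) -> _) \o @cover (syzygy M n.+1).

Lemma cover_surj (V : lmodType R) (x : V) : exists D, cover D = x.
Proof. by exists << 1 *g x >>; rewrite /cover liftU scale1r. Qed.

Lemma free_res_exact0 (M : lmodType R) (y : free_res M 0) :
  @cover M y = 0 <-> exists x, free_res_diff M 0 x = y.
Proof.
split=> [/eqP y0 | [x <-]]; last by apply/eqP; exact: (valP (cover x)).
by have [x xE] := cover_surj (Kernel y0 : syzygy M 1); exists x;
rewrite /= xE.
Qed.

Lemma free_res_exact (M : lmodType R) n (y : free_res M n.+1) :
  free_res_diff M n y = 0 <-> exists x, free_res_diff M n.+1 x = y.
Proof.
split=> [y0 | [x <-]]; last first.
  by rewrite /= (eqP (valP (cover x) : cover _ == 0)).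
have {}y0 : y \in ker_pred (@cover (syzygy M n.+1)).
  by rewrite inE; apply/eqP; apply: val_inj; exact: y0.
by have [x xE] := cover_surj (Kernel y0 : syzygy M n.+2); exists x;
rewrite /= xE.
Qed.

End FreeResolution.

Section Ext.
Variable R : comNzRingType.

(* H^n of the complex Hom(P_0, N) -> Hom(P_1, N) -> ..., where P = free_res M *)
Definition Ext (n : nat) (M N : lmodType R) : lmodType R :=
  if n is n'.+1 then
    cohomology (precomp N (free_res_diff M n')) (precomp N (free_res_diff M n'.+1))
  else kernel (precomp N (free_res_diff M 0)).

End Ext.

Section FractionModule.
Variable R : idomainType.

Definition frac_scale (a : R) (x : {fraction R}) : {fraction R} := tofrac a * x.

Fact frac_scaleA a b x : frac_scale a (frac_scale b x) = frac_scale (a * b) x.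
Proof. by rewrite /frac_scale rmorphM mulrA. Qed.

Fact frac_scale1 : left_id 1 frac_scale.
Proof. by move=> x; rewrite /frac_scale rmorph1 mul1r. Qed.

Fact frac_scaleDr : right_distributive frac_scale +%R.
Proof. by move=> a x y; rewrite /frac_scale mulrDr. Qed.

Fact frac_scaleDl x : {morph frac_scale^~ x : a b / a + b}.
Proof. by move=> a b; rewrite /frac_scale rmorphD mulrDl. Qed.

HB.instance Definition _ := GRing.Zmodule_isLmodule.Build R {fraction R}
  frac_scaleA frac_scale1 frac_scaleDr frac_scaleDl.

Definition weakly_cotorsion (X : lmodType R) : Prop :=
  forall x : Ext 1 {fraction R} X, x = 0.

End FractionModule.

Section RegularLocal.
Variable R : comNzRingType.
Implicit Types I m p : {pred R}.

Definition generates n (g : 'I_n -> R) I : Prop :=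
  forall x, x \in I <-> exists c : 'I_n -> R, x = \sum_(i < n) c i * g i.

(* In ring_quotient.v, idealr_closed I says that I is a proper ideal; the unit ideal, which the
   quantifier below leaves out, is always generated by 1. *)
Definition noetherian : Prop :=
  forall I, idealr_closed I -> exists n (g : 'I_n -> R), generates g I.

Definition maximal_ideal m : Prop :=
  idealr_closed m /\
  forall I, idealr_closed I -> {subset m <= I} -> I =i m.

Definition local_ring m : Prop :=
  maximal_ideal m /\ forall m', maximal_ideal m' -> m' =i m.

Definition prime_ideal p : Prop := idealr_closed p /\ prime_idealr_closed p.

(* there are primes p 0 < p 1 < ... < p n *)
Definition has_prime_chain n : Prop :=
  exists p : nat -> {pred R},
    (forall i, (i <= n)%N -> prime_ideal (p i)) /\
    (forall i, (i < n)%N -> {subset p i <= p i.+1} /\ ~ {subset p i.+1 <= p i}).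

Definition krull_dim d : Prop := has_prime_chain d /\ ~ has_prime_chain d.+1.

(* d is both the Krull dimension of R and the least number of generators of m *)
Definition regular_local_ring m d : Prop :=
  [/\ noetherian, local_ring m, krull_dim d,
      exists g : 'I_d -> R, generates g m &
      forall n (g : 'I_n -> R), generates g m -> (d <= n)%N].

End RegularLocal.

(* Main.v *)
(* R is a principal ideal domain, by the Krull intersection theorem for its uniformizer.  Let
   0 -> K_M -> P_M -> M -> 0 and 0 -> K_Q -> P_Q -> Q -> 0 be the canonical presentations.
   Over R a submodule K of a free module P is projective and divisible modules are injective, so
   if D : W0 -> W1 has divisible cokernel, every K -> W1 is of the form D psi up to a map
   extending to P.  Applied to Hom(K_M, N) ->> Ext^1(M, N), any theta : K_Q -> Ext^1(M, N) is
   thus represented, up to such maps, by a bilinear K_Q x K_M -> N, i.e. by K_M -> Hom(K_Q, N).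
   The cokernel Ext^1(Q, N) of the restriction Hom(P_Q, N) -> Hom(K_Q, N) is divisible, so this
   map lifts to K_M -> Hom(P_Q, N) up to a map extending to P_M, which vanishes in Ext^1(M, N).
   Hence theta extends to P_Q. *)
From HB Require Import structures.
From mathcomp Require Import all_boot all_algebra.
From mathcomp Require Import boolp classical_sets.
From mathcomp Require Import freeg.
From mathcomp Require Import ring.
Require Import Defs.

Set Implicit Arguments.
Unset Strict Implicit.
Unset Printing Implicit Defensive.

Import GRing.Theory.

Local Open Scope ring_scope.
Local Open Scope quotient_scope.
Local Open Scope classical_set_scope.

(** * Zorn's lemma, maximal ideals and principality of R *)

(** The empty chain is bounded by [A0]. This matters below because the empty set is neither an ideal
    nor a partial solution. *)
Lemma Zorn_bigcup_nonempty (T : Type) (P : set (set T)) (A0 : set T) :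
    P A0 ->
    (forall F : set (set T), F `<=` P -> F !=set0 -> total_on F subset ->
      P (\bigcup_(X in F) X)) ->
  exists A, P A /\ forall B, A `<=` B -> P B -> B `<=` A.
Proof.
move=> PA0 Pcup; pose R (s t : {A | P A}) := `[< sval s `<=` sval t >].
have [||F totF|[A PA] Amax] := @ZL_preorder _ (exist _ A0 PA0) R.
- by move=> ?; apply/asboolP.
- by move=> ? ? ? /asboolP rs /asboolP st; apply/asboolP/(subset_trans rs st).
- have [->|/set0P[s0 Fs0]] := eqVneq F set0; first by exists (exist _ A0 PA0).
  have PF : P (\bigcup_(X in [set sval s | s in F]) X).
    apply: Pcup => [_ [s _ <-]||_ _ [s Fs <-] [t Ft <-]].
    - exact: (proj2_sig s).
    - by exists (sval s0), s0.
    - by have [/asboolP|/asboolP] := totF s t Fs Ft; [left|right].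
  exists (exist _ _ PF) => s Fs; apply/asboolP => x sx.
  by exists (sval s) => //; exists s.
- exists A; split=> // B AB PB.
  exact/asboolP/(Amax (exist _ B PB))/asboolP.
Qed.

(** The unit ideal is allowed, unlike in [idealr_closed]: the coefficient ideals of the lifting
    argument can be all of R. *)
Definition ideal (R : pzRingType) (I : set R) : Prop :=
  I 0 /\ forall a u v, I u -> I v -> I (a * u + v).

Definition pir (R : pzRingType) : Prop :=
  forall I : set R, ideal I ->
  exists2 a, I a & forall x, I x -> exists c, x = c * a.

(** Zorn's lemma for the ideals containing [x] but not 1, starting from R x, which is proper because
    [x] is not a unit. *)
Lemma in_maximal_ideal (R : comNzRingType) (x : R) :
  (forall c, c * x != 1) -> exists2 m, maximal_ideal m & x \in m.
Proof.
move=> xN1.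
pose P : set (set R) := [set I | [/\ ideal I, I x & ~ I 1]].
have Px : P [set y | exists c, y = c * x].
  split=> [||[c /esym/eqP]]; last by apply/negP.
  - split=> [|a _ _ [b ->] [c ->]]; first by exists 0; rewrite mul0r.
    by exists (a * b + c); ring.
  - by exists 1; rewrite mul1r.
have [F FP [I0 FI0] totF|I [[[I0 IP] Ix I1] Imax]] := Zorn_bigcup_nonempty Px.
  split; last by move=> [I FI]; have [] := FP _ FI.
    split; first by exists I0 => //; have [[]] := FP _ FI0.
    move=> a u v [I FI Iu] [J FJ Jv].
    have [/(_ _ Iu) Ju|/(_ _ Jv) Iv] := totF I J FI FJ.
      by exists J => //; have [[_ JP] _ _] := FP _ FJ; apply: JP.
    by exists I => //; have [[_ IP] _ _] := FP _ FI; apply: IP.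
  by exists I0 => //; have [] := FP _ FI0.
exists (fun y => `[< I y >]); last exact/asboolP.
split.
  split; [exact/asboolP | exact/asboolP|].
  by move=> a u v /asboolP Iu /asboolP Iv; apply/asboolP/IP.
move=> J [J0 J1 JP] IJ y; apply/idP/idP; last exact: IJ.
move=> Jy; apply/asboolP; apply: (Imax [set z | z \in J]) => //=.
  by move=> z Iz; apply: IJ; apply/asboolP.
split; [split=> // a u v; exact: JP | | exact/negP].
by apply: (IJ x); apply/asboolP.
Qed.

Lemma local_ring_unit (R : comNzRingType) (m : {pred R}) (x : R) :
  local_ring m -> x \notin m -> exists c, c * x = 1.
Proof.
move=> [_ mP] xm; apply: contrapT => xN1.
have [|m' m'max xm'] := @in_maximal_ideal R x.
  by move=> c; apply/eqP => cx; apply: xN1; exists c.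
by move: xm; rewrite -(mP _ m'max) xm'.
Qed.

(** The elements that some power of t carries into R y form an ideal I. As I is finitely generated,
    one t^N carries all of I into R y. Writing y = t^(N+1) x puts x in I, so t^N x = c y = c t (t^N
    x), and t would be a unit if y were nonzero. *)
Lemma krull_intersection_principal (R : idomainType) (t y : R) :
  noetherian R -> (forall c, c * t != 1) ->
  (forall n, exists x, y = t ^+ n * x) -> y = 0.
Proof.
move=> noeR tN1 yt; apply: contrapT => /eqP y0.
have t0 : t != 0.
  by apply: contraNneq y0 => t0; have [x ->] := yt 1; rewrite t0 mul0r.
pose I : {pred R} := [pred z | `[< exists n c, t ^+ n * z = c * y >]].
have Iideal : idealr_closed I.
  split.
  - by apply/asboolP; exists 0%N, 0; rewrite mulr0 mul0r.
  (* [I] is proper: t^n = c y together with y = t^(n+1) x would make t a unit. *)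
  - apply/asboolP => -[n [c E]]; have [x yx] := yt n.+1.
    have /eqP : t ^+ n * (c * x * t - 1) = 0.
      transitivity (c * (t ^+ n.+1 * x) - t ^+ n); first by rewrite exprSr; ring.
      by rewrite -yx -E mulr1 subrr.
    by rewrite mulf_eq0 expf_eq0 (negPf t0) andbF subr_eq0 (negPf (tN1 _)).
  - move=> a u v /asboolP[n [c cE]] /asboolP[k [d dE]]; apply/asboolP.
    exists (n + k)%N, (a * t ^+ k * c + t ^+ n * d).
    rewrite exprD; transitivity (a * t ^+ k * (t ^+ n * u) + t ^+ n * (t ^+ k * v)).
      by ring.
    by rewrite cE dE; ring.
have [k [g gI]] := noeR _ Iideal.
have {}gP i : exists n, exists c, t ^+ n * g i = c * y.
  apply/asboolP; apply/gI; exists (fun j => (j == i)%:R).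
  rewrite (bigD1 i) //= eqxx mul1r big1 ?addr0 // => j /negPf->.
  by rewrite mul0r.
have [n nP] := choice gP.
(* The sum dominates every [n i], so one exponent serves all generators. *)
pose N := (\sum_i n i)%N.
have NI z : z \in I -> exists c, t ^+ N * z = c * y.
  move=> /gI[c ->]; rewrite mulr_sumr.
  elim/big_ind: _ => [|_ _ [a ->] [b ->]|i _].
  - by exists 0; rewrite mul0r.
  - by exists (a + b); rewrite mulrDl.
  - have [d dE] := nP i; exists (c i * t ^+ (N - n i) * d).
    rewrite -[in LHS](@subnK (n i) N) ?leq_sum_fintype //; last first.
      by rewrite /N (bigD1 i) //= leq_addr.
    by rewrite exprD -[RHS]mulrA -dE; ring.
have [x yx] := yt N.+1.
have [|c cE] := NI x.
  by apply/asboolP; exists N.+1, 1; rewrite mul1r.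
have /eqP : (t ^+ N * x) * (c * t - 1) = 0.
  by rewrite mulrBr mulr1 {2}cE yx exprSr; ring.
rewrite mulf_eq0 subr_eq0 (negPf (tN1 _)) orbF => /eqP tx0.
by move/eqP: y0; apply; rewrite yx exprS -mulrA tx0 mulr0.
Qed.

(** By Krull intersection every nonzero element is a unit times a power of the generator [t] of m,
    so a nonzero ideal is generated by the least power of [t] in it. *)
Lemma pir_of_regular_local (R : idomainType) (m : {pred R}) :
  regular_local_ring m 1 -> pir R.
Proof.
case=> noeR locR _ [g gm] _.
pose t := g ord0.
have mP x : x \in m <-> exists c, x = c * t.
  split=> [/gm[c ->]|[c ->]]; first by exists (c ord0); rewrite big_ord1.
  by apply/gm; exists (fun=> c); rewrite big_ord1.
have tN1 c : c * t != 1.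
  have [[[_ m1 _] _] _] := locR.
  by apply: contraNneq m1 => <-; apply/mP; exists c.
have factor y : y != 0 -> exists n u v, y = t ^+ n * u /\ v * u = 1.
  move=> y0.
  have exn : exists n, ~~ `[< exists x, y = t ^+ n * x >].
    apply: contrapT => yt; move/eqP: y0; apply.
    apply: (krull_intersection_principal noeR tN1) => n.
    by apply: contrapT => yn; apply: yt; exists n; apply/asboolP.
  (* If [k.+1] is the least exponent whose power of [t] does not divide [y], the cofactor of
     [t ^+ k] lies outside m and is a unit. *)
  case: (ex_minnP exn) => -[|k].
    by move=> /asboolP[]; exists y; rewrite mul1r.
  move=> /asboolP kP kmin.
  have [u yu] : exists u, y = t ^+ k * u.
    by apply: contrapT => yk; have := kmin k; rewrite ltnn => /(_ _)/notF; apply;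
      apply/asboolP.
  have [|v vu] := @local_ring_unit R m u locR; last by exists k, u, v.
  by apply/negP => /mP[c uE]; apply: kP; exists c; rewrite yu uE exprSr; ring.
move=> I [I0 IP].
have IM a u : I u -> I (a * u) by move=> Iu; rewrite -[_ * _]addr0; apply: IP.
have [[y [Iy y0]]|Iz] := pselect (exists y, I y /\ y != 0); last first.
  exists 0 => // x Ix; exists 0; rewrite mulr0; apply: contrapT => /eqP x0.
  by apply: Iz; exists x.
have It n u v x : I x -> x = t ^+ n * u -> v * u = 1 -> I (t ^+ n).
  move=> Ix xE vu; suff -> : t ^+ n = v * x by apply: IM.
  by rewrite xE mulrCA vu mulr1.
have exn : exists n, `[< I (t ^+ n) >].
  by have [n [u [v [yE vu]]]] := factor y y0; exists n; apply/asboolP/(It _ _ _ y Iy yE vu).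
case: (ex_minnP exn) => n /asboolP In nmin.
exists (t ^+ n) => // x Ix.
have [->|x0] := eqVneq x 0; first by exists 0; rewrite mul0r.
have [k [u [v [xE vu]]]] := factor x x0.
have /subnK nk : (n <= k)%N by apply: nmin; apply/asboolP/(It _ _ _ x Ix xE vu).
by exists (t ^+ (k - n) * u); rewrite xE -{1}nk exprD mulrAC.
Qed.

(** * Linear maps out of free modules, and supports *)

Section FreegLift.
Variables (R : nzRingType) (T : choiceType) (W : lmodType R).
Implicit Types (f g : T -> W) (p : {freeg T / R}).

Lemma fglift_linear f : linear (fglift f : {freeg T / R} -> W).
Proof.
have fB := lift_is_additive f.
have f0 : fglift f 0 = 0 by rewrite -(subrr 0) fB subrr.
have fD : {morph fglift f : p q / p + q}.
  by move=> q r; rewrite -{1}[r]opprK fB -[- r]sub0r fB f0 sub0r opprK.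
have fsum (F : T -> {freeg T / R}) s :
    fglift f (\sum_(x <- s) F x) = \sum_(x <- s) fglift f (F x).
  exact: (big_morph _ fD f0).
move=> a p q; rewrite fD; congr (_ + _).
rewrite [a *: p]/(fgscale a p) fsum -[in RHS](freeg_sumE p) fsum scaler_sumr.
by apply: eq_bigr => x _; rewrite !liftU scalerA.
Qed.

HB.instance Definition _ f := GRing.isLinear.Build R {freeg T / R} W *:%R
  (fglift f) (fglift_linear f).

Lemma fglift_sum f p : fglift f p = \sum_(x <- dom p) coeff x p *: f x.
Proof.
rewrite -[in LHS](freeg_sumE p) linear_sum.
by apply: eq_bigr => x _; apply: liftU.
Qed.

Lemma eq_fglift f g p : {in dom p, f =1 g} -> fglift f p = fglift g p.
Proof.
by move=> fg; rewrite !fglift_sum; apply: eq_big_seq => x /fg->.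
Qed.

(** Isolates the value at one basis element, the unknown to solve for when a partial solution is
    extended. *)
Lemma fglift_update f x w p :
  fglift (fun y => if y == x then w else f y) p =
  fglift (fun y => if y == x then 0 else f y) p + coeff x p *: w.
Proof.
rewrite !fglift_sum; have [xp|xp] := boolP (x \in dom p).
  rewrite !(bigD1_seq x) ?uniq_dom //= eqxx scaler0 add0r addrC; congr (_ + _).
  by apply: eq_bigr => y /negPf->.
rewrite coeff_outdom // scale0r addr0; apply: eq_big_seq => y yp.
by case: eqP => // yx; rewrite -yx yp in xp.
Qed.

End FreegLift.

Section FreegDom.
Variables (R : nzRingType) (T : choiceType).
Implicit Types (S : set T) (p q : {freeg T / R}).

Definition supported S p := {in dom p, forall x, S x}.

Lemma supportedP S p : supported S p <-> forall x, coeff x p != 0 -> S x.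
Proof. by split=> Sp x; have := Sp x; rewrite mem_dom. Qed.

Lemma supported_linear S a p q :
  supported S p -> supported S q -> supported S (a *: p + q).
Proof.
move=> /supportedP Sp /supportedP Sq; apply/supportedP => x.
have [px|/Sp//] := eqVneq (coeff x p) 0.
by rewrite coeffD coeffZ px mulr0 add0r => /Sq.
Qed.

Lemma sub_supported S S' p : S `<=` S' -> supported S p -> supported S' p.
Proof. by move=> SS' Sp x /Sp/SS'. Qed.

Lemma supported0 p : supported set0 p -> p = 0.
Proof.
rewrite /supported => p0; apply/eqP; rewrite -dom_eq0.
by case: (dom p) p0 => // x s /(_ x (mem_head _ _)).
Qed.

End FreegDom.

(** * Lifting along a map with divisible cokernel *)

(* [inl (x, w)] encodes h x = w and [inr (k, w)] encodes psi k = w, so that chains of partial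
   solutions have their plain union as upper bound. *)
Section Lifting.
Variables (R : idomainType) (T : choiceType) (K W0 W1 : lmodType R).
Variables (j : {linear K -> {freeg T / R}}) (D : {linear W0 -> W1}).
Variable phi : {linear K -> W1}.

Definition defined (G : set (T * W1 + K * W0)) : set T :=
  [set x | exists w, G (inl (x, w))].

(** Given linearity, the condition at 0 makes psi single-valued. The third and fifth clauses make
    its domain exactly the k whose image lies in the span of [defined G]. *)
Definition partial_solution (G : set (T * W1 + K * W0)) : Prop :=
  [/\ forall x w w', G (inl (x, w)) -> G (inl (x, w')) -> w = w',
      forall w, G (inr (0, w)) -> w = 0,
      forall k, supported (defined G) (j k) -> exists w, G (inr (k, w)),
      forall a k w k' w', G (inr (k, w)) -> G (inr (k', w')) ->
        G (inr (a *: k + k', a *: w + w')) &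
      forall k w, G (inr (k, w)) -> exists2 h,
        {in dom (j k), forall x, G (inl (x, h x))} &
        D w = phi k + fglift h (j k)].

Hypothesis j_inj : injective j.

Lemma partial_solution_trivial : partial_solution [set inr (0, 0)].
Proof.
split=> //=.
- by move=> w [].
- move=> k k0; exists 0; congr (inr (_, _)); apply: j_inj; rewrite linear0.
  apply: (@supported0 _ _ (j k)); apply: sub_supported k0.
  by move=> x [].
- by move=> a k w k' w' [-> ->] [-> ->]; rewrite !scaler0 !addr0.
- move=> k w [-> ->]; exists (fun=> 0); last by rewrite !linear0 addr0.
  by move=> x; rewrite linear0 dom0.
Qed.

(** Supports are finite, so each is already covered by one member of the chain. *)
Lemma defined_chain (F : set (set (T * W1 + K * W0))) (s : seq T) :
  F !=set0 -> total_on F subset ->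
  {in s, forall x, defined (\bigcup_(G in F) G) x} ->
  exists2 G, F G & {in s, forall x, defined G x}.
Proof.
move=> [G0 FG0] totF; elim: s => [|x s IHs] Fxs; first by exists G0.
have [|G FG Gs] := IHs; first by move=> y ys; apply: Fxs; rewrite inE ys orbT.
have [w [H FH Hx]] := Fxs x (mem_head x s).
have [GH|HG] := totF G H FG FH.
  exists H => // y; rewrite inE => /predU1P[->|/Gs[v /GH]]; first by exists w.
  by exists v.
exists G => // y; rewrite inE => /predU1P[->|/Gs//].
by exists w; apply: HG.
Qed.

Lemma partial_solution_bigcup (F : set (set (T * W1 + K * W0))) :
  F `<=` partial_solution -> F !=set0 -> total_on F subset ->
  partial_solution (\bigcup_(G in F) G).
Proof.
move=> FP F0 totF.
have tot2 s t : (\bigcup_(G in F) G) s -> (\bigcup_(G in F) G) t ->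
    exists G, [/\ F G, G s & G t].
  move=> [G FG Gs] [H FH Ht].
  have [/(_ _ Gs) Hs|/(_ _ Ht) Gt] := totF G H FG FH; first by exists H.
  by exists G.
split.
- move=> x w w' Fw /(tot2 _ _ Fw)[G [/FP[Gfun _ _ _ _] Gw Gw']].
  exact: Gfun Gw Gw'.
- by move=> w [G /FP[_ G0 _ _ _] /G0].
- move=> k /(defined_chain F0 totF)[G FG Gk].
  by have [_ _ /(_ k Gk)[w Gw] _ _] := FP _ FG; exists w; exists G.
- move=> a k w k' w' Fk /(tot2 _ _ Fk)[G [FG Gk Gk']].
  by exists G => //; have [_ _ _ Glin _] := FP _ FG; apply: Glin.
- move=> k w [G FG Gk]; have [_ _ _ _ /(_ _ _ Gk)[h hG Dw]] := FP _ FG.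
  by exists h => // x /hG; exists G.
Qed.

Hypothesis pirR : pir R.
(** This is divisibility of the cokernel of [D]. *)
Hypothesis cokerD : forall (a : R) c, a != 0 -> exists y h, D y = c + a *: h.

Lemma partial_solution_extend G x : partial_solution G -> ~ defined G x ->
  exists G', [/\ G `<=` G', partial_solution G' & defined G' x].
Proof.
move=> [Gfun G0 Gtot Glin Geq] NGx.
have [h0 h0P] : exists h0, forall y, defined G y -> G (inl (y, h0 y)).
  have /choice[h hP] : forall y, exists w, defined G y -> G (inl (y, w)).
    move=> y; have [[w Gw]|Gy] := pselect (defined G y); first by exists w.
    by exists 0.
  by exists h.
pose S := defined G `|` [set x].
have coefG k w : G (inr (k, w)) -> coeff x (j k) = 0.
  move=> /Geq[h hG _]; apply: coeff_outdom; apply/negP => /hG Gx.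
  by apply: NGx; exists (h x).
have GS k w : G (inr (k, w)) -> supported S (j k).
  by move=> /Geq[h hG _] y /hG Gy; left; exists (h y).
pose h h1 y := if y == x then h1 else h0 y.
have hG h1 y : defined G y -> G (inl (y, h h1 y)).
  rewrite /h; case: eqP => [->/NGx//|_]; exact: h0P.
have GD k w h1 : G (inr (k, w)) -> D w = phi k + fglift (h h1) (j k).
  move=> /Geq[g gG ->]; congr (_ + _); apply: eq_fglift => y /gG Gy.
  by apply: (Gfun _ _ _ Gy (hG _ _ _)); exists (g y).
have coef_ideal : ideal [set a | exists k,
    supported S (j k) /\ coeff x (j k) = a].
  split=> [|a _ _ [k [Sk <-]] [k' [Sk' <-]]].
    by exists 0; rewrite !linear0 coeff0; split=> // y; rewrite dom0.
  exists (a *: k + k'); rewrite linearP; split; last by rewrite coeffD coeffZ.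
  exact: supported_linear.
have [_ [k0 [Sk0 <-]] k0P] := pirR coef_ideal.
(* If the coefficient ideal is zero the domain of psi does not grow, and [k1], [w1], [h1] are all 0;
   otherwise [k1] is [k0]. *)
have [k1 [w1 [h1 [Sk1 Dw1 k1P k1_eq0]]]] : exists k1 w1 h1,
    [/\ supported S (j k1), D w1 = phi k1 + fglift (h h1) (j k1),
      forall k, supported S (j k) ->
        exists c, coeff x (j k) = c * coeff x (j k1) &
      coeff x (j k1) = 0 -> k1 = 0 /\ w1 = 0].
  have [a0|a0] := eqVneq (coeff x (j k0)) 0.
    exists 0, 0, 0; rewrite !linear0 addr0; split=> // [y|k Sk].
      by rewrite dom0.
    have [|c ->] := k0P (coeff x (j k)); first by exists k.
    by exists c; rewrite a0 coeff0.
  (* With value 0 at [x] the equation at [k0] has a defect; divisibility by the coefficient at [x]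
     absorbs it into [h1]. *)
  have [w1 [h1 Dw1]] := cokerD (phi k0 + fglift (h 0) (j k0)) a0.
  exists k0, w1, h1; split=> // [|k Sk|/eqP]; last by rewrite (negPf a0).
    by rewrite Dw1 -addrA -fglift_update.
  by apply: k0P; exists k.
pose G' : set (T * W1 + K * W0) := fun s => match s with
  | inl (y, w) => G (inl (y, w)) \/ y = x /\ w = h1
  | inr (k, w) => exists r k' w', [/\ G (inr (k', w')),
      k = r *: k1 + k' & w = r *: w1 + w']
  end.
have hG' y : S y -> G' (inl (y, h h1 y)).
  case=> [Gy|->]; first by left; apply: hG.
  by right; rewrite /h eqxx.
have SG' y : defined G' y -> S y.
  by case=> w [Gy|[-> _]]; [left; exists w|right].
exists G'; split.
- by move=> [[y w] Gy|[k w] Gk]; [left|exists 0, k, w; rewrite !scale0r !add0r].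
- split.
  + move=> y w w' [Gw|[-> ->]] [Gw'|[yx ->]] //.
    * exact: Gfun Gw Gw'.
    * by rewrite yx in Gw; case: NGx; exists w.
    * by case: NGx; exists w'.
  + move=> w [r [k' [w' [Gk' k'E ->]]]].
    (* Comparing coefficients at [x] in a domain, either r = 0, or [k1] and [w1] vanish by their
       choice. *)
    have : coeff x (j (r *: k1 + k')) = 0 by rewrite -k'E linear0 coeff0.
    rewrite linearP coeffD coeffZ (coefG _ _ Gk') addr0 => /eqP.
    rewrite mulf_eq0 => /orP[/eqP r0|/eqP/k1_eq0[k10 w10]].
      by move: k'E Gk'; rewrite r0 !scale0r !add0r => <- /G0.
    by move: k'E Gk'; rewrite k10 w10 !scaler0 !add0r => <- /G0.
  + move=> k Gk; have Sk : supported S (j k) by move=> y /Gk/SG'.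
    have [c cE] := k1P k Sk.
    (* Subtracting [c *: k1] kills the coefficient at [x], which brings the remainder into the old
       domain. *)
    have kE : k = c *: k1 + (- c *: k1 + k) by rewrite scaleNr addNKr.
    have [|w' Gw'] := Gtot (- c *: k1 + k).
      rewrite linearP => y yS; have := supported_linear (a := - c) Sk1 Sk yS.
      case=> // yx; move: yS; rewrite yx mem_dom coeffD coeffZ cE.
      by rewrite mulNr addNr eqxx.
    by exists (c *: w1 + w'), c, (- c *: k1 + k), w'.
  + move=> a k w k' w' [r [l [v [Gl -> ->]]]] [r' [l' [v' [Gl' -> ->]]]].
    exists (a * r + r'), (a *: l + l'), (a *: v + v'); split; first exact: Glin.
      by rewrite scalerDr scalerA scalerDl addrACA.
    by rewrite scalerDr scalerA scalerDl addrACA.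
  + move=> k w [r [k' [w' [Gk' -> ->]]]]; exists (h h1).
      rewrite linearP => y yS; apply: hG'.
      exact: (supported_linear Sk1 (GS _ _ Gk') yS).
    by rewrite !linearP Dw1 (GD _ _ h1 Gk') scalerDr addrACA.
- by exists h1; right.
Qed.

(** A maximal partial solution is defined on all of [T], so psi is total. One Zorn argument thus
    combines lifting from a submodule of a free module with extension into a divisible cokernel. *)
Theorem lift_modulo_divisible :
  exists (psi : hom K W0) (eta : hom {freeg T / R} W1),
    forall k, D (psi k) = phi k + eta (j k).
Proof.
have [G [GP Gmax]] :=
  Zorn_bigcup_nonempty partial_solution_trivial partial_solution_bigcup.
have Gdef x : defined G x.
  apply: contrapT => NGx.
  have [G' [GG' G'P [w G'w]]] := partial_solution_extend GP NGx.
  by apply: NGx; exists w; apply: (Gmax G').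
have [Gfun G0 Gtot Glin Geq] := GP.
have [h hG] := choice Gdef.
have /choice[psi psiG] : forall k, exists w, G (inr (k, w)).
  by move=> k; apply: Gtot => x _; apply: Gdef.
have psiL : linear psi.
  (* The defect of linearity is a value of psi at 0, hence zero. *)
  move=> a k k'.
  have := Glin (- 1) _ _ _ _ (Glin a _ _ _ _ (psiG k) (psiG k'))
    (psiG (a *: k + k')).
  by rewrite !scaleN1r addNr => /G0/addr0_eq; rewrite opprK => ->.
exists (Hom (asboolT psiL)), (Hom (asboolT (fglift_linear h))) => k /=.
have [g gG ->] := Geq _ _ (psiG k); congr (_ + _); apply: eq_fglift => x /gG Gx.
exact: Gfun Gx (hG x).
Qed.

End Lifting.

(** * Ext^1 as a quotient of the homomorphisms on the first syzygy *)

Lemma hom_ext (R : comPzRingType) (U V : lmodType R) (f g : hom U V) :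
  f =1 g -> f = g.
Proof. by move=> fg; apply: val_inj; apply: funext. Qed.

Section ExtClass.
Variables (R : comNzRingType) (M N : lmodType R).

Let K : lmodType R := syzygy M 1.
Let P : lmodType R := free_res M 0.

Lemma ext_cocycle (f : hom K N) :
  precomp N (@cover R K) f \in ker_pred (precomp N (free_res_diff M 1)).
Proof.
apply/eqP/hom_ext => x /=.
by rewrite (eqP (valP (cover x) : cover _ == 0)) linear0.
Qed.

(* The connecting map Hom(K, N) -> Ext^1(M, N) of 0 -> K -> P -> M -> 0. *)
Definition ext_class (f : hom K N) : Ext 1 M N :=
  \pi_(Ext 1 M N) (Kernel (ext_cocycle f)).

Lemma ext_class_linear : linear ext_class.
Proof.
move=> a f g; transitivity (\pi_(Ext 1 M N)
    (a *: Kernel (ext_cocycle f) + Kernel (ext_cocycle g))).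
  by congr (\pi_(_) _); apply: val_inj; rewrite /= linearP.
by rewrite raddfD; congr (_ + _); symmetry; exact: pi_cohomology_scale.
Qed.

HB.instance Definition _ := GRing.isLinear.Build R (hom K N) (Ext 1 M N)
  *:%R ext_class ext_class_linear.

(** A cocycle vanishes on the image of the differential, which is the kernel of P_1 -> K, so it
    factors through K; the factor is read off on the basis elements of P_1. *)
Lemma ext_class_surj x : exists f, ext_class f = x.
Proof.
pose z : hom (free_res M 1) N := val (repr x).
have z0 (p : free_res M 1) : @cover R K p = 0 -> z p = 0.
  move=> p0; have /free_res_exact[q <-] : free_res_diff M 0 p = 0.
    by rewrite /= p0.
  have /eqP zd := valP (repr x) : precomp N (free_res_diff M 1) z == 0.
  by have /(congr1 (fun f : hom _ _ => f q)) := zd.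
have coverU (k : K) : cover << k >> = k by rewrite /cover liftU scale1r.
have fL : linear (fun k : K => z << k >>).
  move=> a k k'; apply/eqP; rewrite -linearP -subr_eq0 -linearB; apply/eqP/z0.
  by rewrite linearB linearP /= !coverU subrr.
exists (Hom (asboolT fL)); rewrite -[RHS]reprK /ext_class; congr (\pi_(_) _).
apply/val_inj/hom_ext => p /=; apply/eqP.
rewrite -subr_eq0 -linearB; apply/eqP/z0.
by rewrite linearB /= coverU subrr.
Qed.

Lemma ext_class_restriction (f : hom K N) (F : hom P N) :
  (forall k : K, f k = F (val k)) -> ext_class f = 0.
Proof.
move=> fF; rewrite /ext_class -(raddf0 \pi_(Ext 1 M N)).
apply/eqP; rewrite -Quotient.idealrBE subr0; apply/asboolP; exists F.
by apply/hom_ext => p /=; rewrite fF.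
Qed.

End ExtClass.

(** * Divisibility of Ext^1(Q, N) and weak cotorsion *)

Lemma hom_flip (R : comPzRingType) (U V N : lmodType R) (f : hom U (hom V N)) :
  exists g : hom V (hom U N), forall v u, g v u = f u v.
Proof.
have gL v : linear (fun u => f u v) by move=> a u u'; rewrite linearP.
pose g v : hom U N := Hom (asboolT (gL v)).
have gLL : linear g.
  by move=> a v v'; apply: hom_ext => u; rewrite /= linearP.
by exists (Hom (asboolT gLL)).
Qed.

Lemma hom_kernel (R : comPzRingType) (U V W : lmodType R)
    (f : {linear U -> V}) (g : {linear V -> W}) :
  (forall u, g (f u) = 0) ->
  exists h : hom U (kernel g), forall u, val (h u) = f u.
Proof.
move=> gf0; have kerf u : f u \in ker_pred g by apply/eqP.
have hL : linear (fun u => Kernel (kerf u)).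
  by move=> a u u'; apply: val_inj; rewrite /= linearP.
by exists (Hom (asboolT hL)).
Qed.

(* Multiplication by a is bijective on Q and lifts to the endomorphism alpha of the resolution,
   so that p - a alpha p is a homotopy exhibiting f modulo a as a restriction. *)
Lemma fraction_ext_divisible (R : idomainType) (N : lmodType R) (a : R)
    (f : hom (syzygy ({fraction R} : lmodType R) 1) N) :
  a != 0 ->
  exists (g : hom (free_res ({fraction R} : lmodType R) 0) N)
         (h : hom (syzygy ({fraction R} : lmodType R) 1) N),
    precomp N (\val : syzygy ({fraction R} : lmodType R) 1 -> _) g = f + a *: h.
Proof.
move=> a0; set Q := ({fraction R} : lmodType R).
(* [alpha] lifts division by [a] on Q. *)
pose alpha : {linear free_res Q 0 -> free_res Q 0} :=
  fglift (fun q : Q => << (q / tofrac a : Q) >>).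
have coverA p : @cover R Q (a *: alpha p) = @cover R Q p.
  rewrite linearZ /= fglift_sum linear_sum scaler_sumr [RHS]fglift_sum.
  apply: eq_bigr => q _; rewrite linearZ /= {1}/cover liftU scale1r.
  rewrite scalerA mulrC -scalerA; congr (_ *: _).
  by rewrite [LHS]mulrC divfK // tofrac_eq0.
have [u uE] : exists u : hom (free_res Q 0) (syzygy Q 1),
    forall p, val (u p) = p - a *: alpha p.
  have uL : linear (fun p => p - a *: alpha p).
    move=> b p q; rewrite linearP !scalerDr opprD addrACA scalerN !scalerA.
    by rewrite [a * b]mulrC.
  have [|u uE] := @hom_kernel _ _ _ _ (Hom (asboolT uL)) (@cover R Q).
    by move=> p /=; rewrite linearB /= coverA subrr.
  by exists u.
have [v vE] : exists v : hom (syzygy Q 1) (syzygy Q 1),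
    forall k, val (v k) = alpha (val k).
  have vL : linear (fun k : syzygy Q 1 => alpha (val k)).
    by move=> b k k'; rewrite !linearP.
  have [|v vE] := @hom_kernel _ _ _ _ (Hom (asboolT vL)) (@cover R Q).
    move=> k /=; apply/eqP; have := coverA (val k).
    rewrite linearZ /= (eqP (valP k : cover _ == 0)) => /eqP.
    by rewrite [_ *: _]/(tofrac a * _) mulf_eq0 tofrac_eq0 (negPf a0).
  by exists v.
(* On the syzygy [u] is the identity minus [a] times [v], so f u = f - a f v there. *)
exists (precomp N u f), (- precomp N v f); apply: hom_ext => k /=.
have -> : u (val k) = k - a *: v k.
  by apply: val_inj; rewrite uE linearB linearZ /= vE ?scalerN.
by rewrite [LHS](linearB f k (a *: v k)) (linearZ_LR f a (v k)) -scalerN.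
Qed.

Lemma ext_weakly_cotorsion (R : idomainType) (M N : lmodType R) :
  pir R -> weakly_cotorsion (Ext 1 M N).
Proof.
move=> pirR x; have [theta <-] := ext_class_surj x.
set Q := ({fraction R} : lmodType R) in x theta *.
have [a c _|psi [eta psiE]] := lift_modulo_divisible (D := @ext_class R M N)
    (j := \val : syzygy Q 1 -> free_res Q 0) theta val_inj pirR.
  (* The cokernel of [ext_class] is zero, hence divisible. *)
  have [y <-] := ext_class_surj c.
  by exists y, 0; rewrite scaler0 addr0.
have [psi' psi'E] := hom_flip psi.
have [|sigma [rho sigmaE]] := lift_modulo_divisible
    (D := precomp N (\val : syzygy Q 1 -> free_res Q 0))
    (j := \val : syzygy M 1 -> free_res M 0) psi' val_inj pirR.
  exact: fraction_ext_divisible.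
have [sigma' sigma'E] := hom_flip sigma.
have [rho' rho'E] := hom_flip rho.
(* This map on P_Q extends [theta]: on K_Q, [sigma'] differs from [psi] by maps K_M -> N that extend
   to P_M through [rho'], whose classes vanish. *)
have ThetaL : linear (fun p => ext_class (sigma' p) - eta p).
  by move=> a p q; rewrite !linearP /= addrACA -scalerDr.
apply: (@ext_class_restriction _ _ _ _ (Hom (asboolT ThetaL))) => k /=.
apply/eqP; rewrite eq_sym subr_eq -psiE -subr_eq0 -linearB; apply/eqP.
apply: (@ext_class_restriction _ _ _ _ (rho' k)) => l.
have := congr1 (fun f : hom (syzygy Q 1) N => f k) (sigmaE l).
rewrite /= => E; rewrite -[LHS]/(sigma' (val k) l - psi k l).
rewrite sigma'E rho'E E -[X in X - _]/(psi' l k + rho (val l) k) psi'E.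
by rewrite addrAC subrr add0r.
Qed.

Theorem corollary2p8 (R : idomainType) (m : {pred R})
    (hR : regular_local_ring m 1) (M N : lmodType R) :
  weakly_cotorsion (Ext 1 M N).
Proof. exact/ext_weakly_cotorsion/(pir_of_regular_local hR). Qed.
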